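(* Let $D$ be a rad-colon coherent integral domain. Then the following are equivalent: (i) $D$ is min-scattered; (ii) every radical semistar operation on $D$ is spectral.
   Context: Let $D$ be an integral domain with quotient field $K$ and let $\mathbf{F}(D)$ be the set of $D$-submodules of $K$. A semistar operation on $D$ is a map $\star:\mathbf{F}(D)\to\mathbf{F}(D)$, $I\mapsto I^\star$, such that for all $I,J\in\mathbf{F}(D)$ and $x\in K$: $I\subseteq I^\star$; if $I\subseteq J$ then $I^\star\subseteq J^\star$; $(I^\star)^\star=I^\star$; $(xI)^\star=x\cdot I^\star$. A semistar operation $\star$ is stable if $(I\cap J)^\star=I^\star\cap J^\star$ for all $I,J\in\mathbf{F}(D)$. It is quasi-radical if, for every ideal $I$ of $D$, $1\notin I^\star$ implies $1\notin\mathrm{rad}(I)^\star$. It is radical if it is quasi-radical and stable. It is spectral if there is $\Delta\subseteq\mathrm{Spec}(D)$ such that $I^\star=\bigcap_{P\in\Delta}ID_P$ for every $I\in\mathbf{F}(D)$. $D$ is rad-colon coherent if, for every $x\in K$, the radical of the ideal $(D:_Dx)=\{d\in D\mid dx\in D\}$ is the radical of a finitely generated ideal of $D$. For an ideal $I$ of $D$, $\mathrm{Min}(I)$ is the set of minimal primes of $I$, with the subspace topology of the Zariski topology. For a topological space $X$, $\mathcal{D}(X)$ is the set of non-isolated points of $X$; iterating transfinitely, $\mathcal{D}^0(X)=X$, $\mathcal{D}^{\gamma+1}(X)=\mathcal{D}(\mathcal{D}^\gamma(X))$ and $\mathcal{D}^\alpha(X)=\bigcap_{\beta<\alpha}\mathcal{D}^\beta(X)$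 for limit $\alpha$. $X$ is scattered if $\mathcal{D}^\alpha(X)=\emptyset$ for some ordinal $\alpha$. $D$ is min-scattered if $\mathrm{Min}(I)$ is scattered for every ideal $I$ of $D$. *)

(* Defs.v *)
From HB Require Import structures.
From mathcomp Require Import all_boot all_order all_algebra fraction.
From mathcomp Require Import boolp classical_sets wochoice topology.

Set Implicit Arguments.
Unset Strict Implicit.
Unset Printing Implicit Defensive.

Import GRing.Theory.
Local Open Scope classical_set_scope.
Local Open Scope ring_scope.

Notation "x %:F" := (FracField.tofrac x) : ring_scope.

(* Ideals may be improper, unlike those of MathComp's [idealr_closed]. *)
Record ideal (D : idomainType) := Ideal {
  ideal_set :> set D;
  ideal0 : ideal_set 0;
  idealD : forall a b, ideal_set a -> ideal_set b -> ideal_set (a + b);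
  idealM : forall d a, ideal_set a -> ideal_set (d * a) }.

Record submod (D : idomainType) := Submod {
  submod_set :> set {fraction D};
  submod0 : submod_set 0;
  submodD : forall x y, submod_set x -> submod_set y -> submod_set (x + y);
  submodM : forall (d : D) x, submod_set x -> submod_set (d%:F * x) }.

Lemma ideal_inj (D : idomainType) (I J : ideal D) :
  I = J :> set D -> I = J.
Proof.
case: I J => [I I0 ID IM] [J J0 JD JM] /= E; subst J.
by congr Ideal; exact: Prop_irrelevance.
Qed.

Lemma submod_inj (D : idomainType) (I J : submod D) :
  I = J :> set {fraction D} -> I = J.
Proof.
case: I J => [I I0 ID IM] [J J0 JD JM] /= E; subst J.
by congr Submod; exact: Prop_irrelevance.
Qed.

Section SubmodOps.
Variable D : idomainType.
Implicit Types (I J : submod D) (x : {fraction D}).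

Lemma submodI0 I J : (I `&` J) 0.
Proof. by split; exact: submod0. Qed.

Lemma submodID I J x y : (I `&` J) x -> (I `&` J) y -> (I `&` J) (x + y).
Proof. by move=> [? ?] [? ?]; split; exact: submodD. Qed.

Lemma submodIM I J (d : D) x : (I `&` J) x -> (I `&` J) (d%:F * x).
Proof. by move=> [? ?]; split; exact: submodM. Qed.

Definition submodI I J : submod D :=
  Submod (submodI0 I J) (@submodID I J) (@submodIM I J).

Let scale x I : set {fraction D} := [set x * i | i in (I : set _)].

Lemma submod_scale0 x I : scale x I 0.
Proof. by exists 0; [exact: submod0 | rewrite mulr0]. Qed.

Lemma submod_scaleD x I y z : scale x I y -> scale x I z -> scale x I (y + z).
Proof.
move=> [i Ii <-] [j Ij <-].
by exists (i + j); [exact: submodD | rewrite mulrDr].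
Qed.

Lemma submod_scaleM x I (d : D) y : scale x I y -> scale x I (d%:F * y).
Proof.
by move=> [i Ii <-]; exists (d%:F * i); [exact: submodM | rewrite mulrCA].
Qed.

Definition submod_scale x I : submod D :=
  Submod (submod_scale0 x I) (@submod_scaleD x I) (@submod_scaleM x I).

End SubmodOps.

Section IdealOps.
Variable D : idomainType.
Implicit Types (I : ideal D).

Let ext I : set {fraction D} := [set a%:F | a in (I : set D)].

Lemma ideal_ext0 I : ext I 0.
Proof. by exists 0; [exact: ideal0 | rewrite tofrac0]. Qed.

Lemma ideal_extD I x y : ext I x -> ext I y -> ext I (x + y).
Proof.
by move=> [a Ia <-] [b Ib <-]; exists (a + b); [exact: idealD | rewrite tofracD].
Qed.

Lemma ideal_extM I (d : D) x : ext I x -> ext I (d%:F * x).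
Proof.
by move=> [a Ia <-]; exists (d * a); [exact: idealM | rewrite tofracM].
Qed.

Definition submod_of_ideal I : submod D :=
  Submod (ideal_ext0 I) (@ideal_extD I) (@ideal_extM I).

Let radset I : set D := [set d | exists2 n, (0 < n)%N & ideal_set I (d ^+ n)].

Lemma radset0 I : radset I 0.
Proof. by exists 1%N => //; rewrite expr1; exact: ideal0. Qed.

Lemma ideal_sum I n (F : 'I_n -> D) :
  (forall i, ideal_set I (F i)) -> ideal_set I (\sum_(i < n) F i).
Proof.
by move=> IF; apply: (big_ind (fun a => ideal_set I a)) => // *;
  [exact: ideal0 | exact: idealD].
Qed.

Lemma radsetD I a b : radset I a -> radset I b -> radset I (a + b).
Proof.
move=> [m m0 Ia] [n n0 Ib]; exists (m + n)%N; first by rewrite addn_gt0 m0.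
rewrite exprDn; apply: ideal_sum => i; rewrite -mulr_natl; apply: idealM.
have [le_ni|lt_in] := leqP n i.
  by rewrite -(subnK le_ni) exprD mulrA; exact: idealM.
have le_m : (m <= m + n - i)%N by rewrite -addnBA ?leq_addr// ltnW.
by rewrite -(subnK le_m) exprD mulrAC; exact: idealM.
Qed.

Lemma radsetM I d a : radset I a -> radset I (d * a).
Proof. by move=> [n n0 Ia]; exists n => //; rewrite exprMn; exact: idealM. Qed.

Definition rad I : ideal D := Ideal (radset0 I) (@radsetD I) (@radsetM I).

Let genset n (g : 'I_n -> D) : set D :=
  [set d | exists c : 'I_n -> D, d = \sum_(i < n) c i * g i].

Lemma genset0 n (g : 'I_n -> D) : genset g 0.
Proof. by exists (fun=> 0); rewrite big1// => i _; rewrite mul0r. Qed.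

Lemma gensetD n (g : 'I_n -> D) a b :
  genset g a -> genset g b -> genset g (a + b).
Proof.
move=> [c ->] [c' ->]; exists (fun i => c i + c' i).
by rewrite -big_split; apply: eq_bigr => i _; rewrite mulrDl.
Qed.

Lemma gensetM n (g : 'I_n -> D) d a : genset g a -> genset g (d * a).
Proof.
move=> [c ->]; exists (fun i => d * c i).
by rewrite mulr_sumr; apply: eq_bigr => i _; rewrite mulrA.
Qed.

Definition ideal_gen n (g : 'I_n -> D) : ideal D :=
  Ideal (genset0 g) (@gensetD n g) (@gensetM n g).

Definition finitely_generated I : Prop :=
  exists (n : nat) (g : 'I_n -> D), I = ideal_gen g.

Let colonset (x : {fraction D}) : set D :=
  [set d | exists e : D, d%:F * x = e%:F].

Lemma colonset0 x : colonset x 0.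
Proof. by exists 0; rewrite tofrac0 mul0r. Qed.

Lemma colonsetD x a b : colonset x a -> colonset x b -> colonset x (a + b).
Proof.
by move=> [e Ee] [f Ef]; exists (e + f); rewrite !tofracD mulrDl Ee Ef.
Qed.

Lemma colonsetM x d a : colonset x a -> colonset x (d * a).
Proof. by move=> [e Ee]; exists (d * e); rewrite !tofracM -mulrA Ee. Qed.

(* the conductor ideal (D :_D x) *)
Definition colon (x : {fraction D}) : ideal D :=
  Ideal (colonset0 x) (@colonsetD x) (@colonsetM x).

End IdealOps.

Definition rad_colon_coherent (D : idomainType) : Prop :=
  forall x : {fraction D},
    exists2 J : ideal D, finitely_generated J & rad (colon x) = rad J.

Record spec (D : idomainType) := Spec {
  spec_ideal :> ideal D;
  spec_proper : ~ ideal_set spec_ideal 1;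
  spec_prime : forall a b,
    ideal_set spec_ideal (a * b) ->
    ideal_set spec_ideal a \/ ideal_set spec_ideal b }.

Section Zariski.
Variable D : idomainType.

HB.instance Definition _ := gen_eqMixin (spec D).
HB.instance Definition _ := gen_choiceMixin (spec D).

(* the closed sets are the V(S) = {P | S `<=` P}, for arbitrary S `<=` D *)
Definition zariski_open : set_system (spec D) :=
  [set U | exists S : set D, U = ~` [set P : spec D | S `<=` P]].

Lemma zariski_openT : zariski_open setT.
Proof.
exists setT; apply/seteqP; split => // P _ /= TP.
by apply: (@spec_proper _ P); exact: TP.
Qed.

Lemma zariski_openI : setI_closed zariski_open.
Proof.
move=> _ _ [S ->] [S' ->].
exists [set z | exists a b, [/\ S a, S' b & z = a * b]].
apply/seteqP; split => P /=.
  move=> [/existsNP[a /not_implyP[Sa Pa]] /existsNP[b /not_implyP[Sb Pb]]] SP.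
  have : ideal_set P (a * b) by apply: SP; exists a, b.
  by case/spec_prime.
move=> NP; split=> SP; apply: NP => _ [a [b [Sa Sb ->]]].
  by rewrite mulrC; apply: idealM; exact: SP.
by apply: idealM; exact: SP.
Qed.

Lemma zariski_open_bigU (T : Type) (f : T -> set (spec D)) :
  (forall i, zariski_open (f i)) -> zariski_open (\bigcup_i f i).
Proof.
move=> /choice[S fS]; exists (\bigcup_i S i).
apply/seteqP; split => P /=.
  by move=> [i _]; rewrite fS /= => NP SP; apply: NP => a Sa; apply: SP; exists i.
move=> NP; apply: contrapT => NfP; apply: NP => a [i _ Sa].
apply: contrapT => Pa; apply: NfP; exists i => //.
by rewrite fS /= => /(_ _ Sa).
Qed.

HB.instance Definition _ := isOpenTopological.Build (spec D)
  zariski_openT zariski_openI zariski_open_bigU.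

End Zariski.

Definition minimal_primes (D : idomainType) (I : ideal D) : set (spec D) :=
  [set P : spec D | I `<=` P /\
    forall Q : spec D, I `<=` Q -> Q `<=` P -> P `<=` Q].

Section Scattered.
Variable T : topologicalType.
Implicit Types X A : set T.

(* [isolated A] is the set of points of A that are open in the subspace A *)
Definition nonisolated A : set T := A `\` isolated A.

Section WellOrder.
Variables (W : eqType) (R : rel W).

Definition wo_lt (b a : W) : Prop := b != a /\ R b a.

Definition wo_zero (a : W) : Prop := forall b, ~ wo_lt b a.

Definition wo_succ (c a : W) : Prop :=
  wo_lt c a /\ forall b, wo_lt b a -> R b c.

Definition wo_limit (a : W) : Prop :=
  ~ wo_zero a /\ forall c, ~ wo_succ c a.

(* An element a of a well-ordered type stands for the ordinal that is the order
   type of the elements below a, and E a is the corresponding D^alpha(X). *)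
Definition iterated_derived X (E : W -> set T) : Prop :=
  [/\ forall a, wo_zero a -> E a = X,
      forall c a, wo_succ c a -> E a = nonisolated (E c)
    & forall a, wo_limit a -> E a = \bigcap_(b in [set b | wo_lt b a]) E b].

End WellOrder.

Definition scattered X : Prop :=
  exists (W : eqType) (R : rel W) (E : W -> set T) (a : W),
    [/\ well_order R, iterated_derived R X E & E a = set0].

End Scattered.

Definition min_scattered (D : idomainType) : Prop :=
  forall I : ideal D, scattered (minimal_primes I).

Record semistar (D : idomainType) := Semistar {
  star_op :> submod D -> submod D;
  star_ext : forall I : submod D, I `<=` star_op I;
  star_mono : forall I J : submod D, I `<=` J -> star_op I `<=` star_op J;
  star_idem : forall I : submod D, star_op (star_op I) = star_op I;
  star_scale : forall (x : {fraction D}) (I : submod D),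
    star_op (submod_scale x I) = submod_scale x (star_op I) }.

Section SemistarProperties.
Variables (D : idomainType) (star : semistar D).

Definition stable : Prop :=
  forall I J : submod D, star (submodI I J) = submodI (star I) (star J).

Definition quasi_radical : Prop :=
  forall I : ideal D, ~ submod_set (star (submod_of_ideal I)) 1 ->
    ~ submod_set (star (submod_of_ideal (rad I))) 1.

Definition radical : Prop := quasi_radical /\ stable.

Definition localization (P : spec D) : set {fraction D} :=
  [set x | exists a s : D, ~ ideal_set P s /\ x = a%:F / s%:F].

(* the product I D_P inside K *)
Definition submod_loc (I : submod D) (P : spec D) : set {fraction D} :=
  [set x | exists (n : nat) (i u : 'I_n -> {fraction D}),
    [/\ forall k, submod_set I (i k), forall k, localization P (u k)
      & x = \sum_(k < n) i k * u k]].

(* An intersection indexed by the empty set of primes is K. *)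
Definition spectral : Prop :=
  exists Delta : set (spec D), forall I : submod D,
    star I = \bigcap_(P in Delta) submod_loc I P :> set {fraction D}.

End SemistarProperties.

(* Main.v *)
Require Import Defs.
From mathcomp Require Import all_boot all_order all_algebra.
From mathcomp Require Import fraction boolp classical_sets wochoice topology.

(* For a stable star operation, [x \in M^star] iff the ideal [(M :_D x)] lies
   in [F = {I | 1 \in I^star}], so the operation is spectral iff every ideal
   outside F is contained in a prime outside F.
   If D is min-scattered and the radical ideal I is outside F, then an isolated
   point of the space of minimal primes of [I^star `&` D] is such a prime.
   Otherwise some [minimal_primes I0] contains a nonempty X without isolated
   points, and the ideals I with [V(I) `&` X] nowhere dense in X form an F that
   gives a radical operation; every prime over [\bigcap_(P in X) P] is in F, but
   this intersection itself is not. *)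

Set Implicit Arguments.
Unset Strict Implicit.
Unset Printing Implicit Defensive.

Import GRing.Theory.
Local Open Scope classical_set_scope.
Local Open Scope ring_scope.

(** * Well-orders and transfinite induction *)

Section WellOrderTheory.
Variables (W : eqType) (R : rel W).
Hypothesis wo : well_order R.

Lemma wo_refl a : R a a.
Proof.
have Rwo : wo_chain R predT by move=> A _; exact: wo.
exact: (wo_chain_reflexive Rwo).
Qed.

Lemma wo_total a b : R a b || R b a.
Proof.
have Rwo : wo_chain R predT by move=> A _; exact: wo.
exact: (wo_chainW Rwo).
Qed.

Lemma wo_anti a b : R a b -> R b a -> a = b.
Proof.
have Rwo : wo_chain R predT by move=> A _; exact: wo.
by move=> ab ba; apply: (wo_chain_antisymmetric Rwo) => //; apply/andP.
Qed.

Lemma wo_ltNge a b : ~~ R a b -> wo_lt R b a.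
Proof.
move=> ab; have /orP[/idPn//|ba] := wo_total a b.
by split=> //; apply: contraNneq ab => ->; exact: wo_refl.
Qed.

Lemma wo_lt_wf : well_founded (wo_lt R).
Proof.
move=> a; apply: contrapT => Na.
have [|m [[/asboolP mN mmin] _]] := @wo (fun b => `[< ~ Acc (wo_lt R) b >]).
  by exists a; exact/asboolP.
apply: mN; constructor => b [bm Rbm]; apply: contrapT => Nb.
have Rmb : R m b by apply: mmin; exact/asboolP.
by move/eqP: bm; apply; exact: wo_anti.
Qed.

End WellOrderTheory.

(** * Scattered spaces: derived sets and isolated points *)

Section ScatteredTheory.
Variable T : topologicalType.
Implicit Types X Y A : set T.

(** A point of [Y] isolated in a larger set is isolated in [Y]. So if [Y] has no isolated points,
    transfinite induction keeps it inside every [E b], including the empty [E a]. *)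
Lemma scattered_isolated X Y :
  scattered X -> Y `<=` X -> Y !=set0 -> isolated Y !=set0.
Proof.
move=> [W [R [E [a [wo [E0 ES EL] Ea]]]]] YX Y0.
apply: contrapT => iY0.
have YE b : Y `<=` E b.
  elim/(well_founded_ind (wo_lt_wf wo)): b => b IH.
  have [/E0 ->//|b0] := pselect (wo_zero R b).
  have [[c bc]|bL] := pselect (exists c, wo_succ R c b); last first.
    rewrite EL; last by split=> // c bc; apply: bL; exists c.
    by move=> y Yy c cb; exact: IH.
  rewrite (ES _ _ bc) => y Yy; have YEc : Y `<=` E c by apply: IH; case: bc.
  split; [exact: YEc|move=> [_ [V Vy VE]]; apply: iY0; exists y].
  split; [exact: mem_set|exists V => //].
  apply/seteqP; split=> [z [Vz /YEc Ez]|z ->]; first by rewrite -VE.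
  by split=> //; exact: nbhs_singleton.
by case: Y0 => y /(YE a); rewrite Ea.
Qed.

Lemma cantor_injective (f : set T -> T) : ~ injective f.
Proof.
move=> fI; pose A := [set x | exists2 B, f B = x & ~ B x].
have [AfA|AfA] := pselect (A (f A)); last by apply: (AfA); exists A.
by case: (AfA) => B /fI -> /(_ AfA).
Qed.

(* The derived sequence is [E a = X `&` \bigcap_(b < a) nonisolated (E b)],
   indexed by a well-ordering of [set T]: as long as E does not vanish, isolated
   points of the E a yield an injection of [set T] into T. *)
Lemma isolated_scattered X :
  (forall Y, Y `<=` X -> Y !=set0 -> isolated Y !=set0) -> scattered X.
Proof.
move=> Xi; have [R wo] := well_ordering_principle (set T).
pose F a (E : forall b, wo_lt R b a -> set T) : set T :=
  [set x | X x /\ forall b ba, nonisolated (E b ba) x].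
pose E : set T -> set T := Fix (wo_lt_wf wo) (fun=> set T) F.
have EE a : E a = [set x | X x /\ forall b, wo_lt R b a -> nonisolated (E b) x].
  rewrite /E Fix_eq// => {}a f g fg; congr (F a _).
  by apply: functional_extensionality_dep => b; apply: funext => ba; exact: fg.
have EX a : E a `<=` X by rewrite EE => x [].
have ED a b : wo_lt R b a -> E a `<=` nonisolated (E b).
  by move=> ba; rewrite [E a]EE => x [_]; apply.
have [a Ea] : exists a, E a = set0.
  apply: contrapT => NE.
  have /choice[f fE] a : exists x, isolated (E a) x.
    apply: Xi => //; apply/set0P/eqP => Ea; apply: NE; by exists a.
  have flt a b : wo_lt R b a -> f a <> f b.
    by move=> /ED ab fab; have /isolatedS/ab[_] := fE a; apply; rewrite fab.
  apply: (@cantor_injective f) => a b fab; apply: contrapT => /eqP ab.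
  have /orP[Rab|Rba] := wo_total wo a b.
    by apply: (@flt b a).
  by apply: (@flt a b) => //; split=> //; rewrite eq_sym.
exists (set T), R, E, a; split=> //; split.
- move=> b b0; rewrite EE; apply/seteqP; split=> [x []//|x Xx].
  by split=> // c /b0.
- move=> c b [cb bmax]; apply/seteqP; split; first exact: ED.
  move=> x cx; rewrite EE; split=> [|d db]; first by case: cx => /EX.
  have [->//|dc] := eqVneq d c.
  by apply: (@ED c d) => //; [split=> //; exact: bmax|case: cx].
- move=> b [/existsNP[c /contrapT cb] bL]; apply/seteqP.
  split=> [x Ex d db|x Ex].
    by have [] := ED _ _ db _ Ex.
  rewrite EE; split=> [|d db]; first exact: EX (Ex _ cb).
  (* As [d] is not the predecessor of [b], some [e] lies strictly between them, and [E e] is inside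
     [nonisolated (E d)]. *)
  have := bL d; rewrite /wo_succ => /not_andP[//|/existsNP[e /not_implyP[eb]]].
  by move=> /negP/(wo_ltNge wo) de; exact: ED de _ (Ex _ eb).
Qed.

End ScatteredTheory.

(** * Primes, minimal primes, conductors and localizations *)

Section IdealTheory.
Variable D : idomainType.
Implicit Types (I J : ideal D) (M : submod D) (P Q : spec D).

Lemma spec_inj P Q : P = Q :> set D -> P = Q.
Proof.
case: P Q => [P P1 PM] [Q Q1 QM] /= /ideal_inj E; subst Q.
by congr Spec; exact: Prop_irrelevance.
Qed.

Lemma specX P a n : ideal_set P (a ^+ n) -> ideal_set P a.
Proof.
elim: n => [/spec_proper//|n IH].
by rewrite exprS => /spec_prime[].
Qed.

Lemma minimal_prime_eq I P Q :
  minimal_primes I P -> I `<=` Q -> Q `<=` P -> Q = P.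
Proof.
move=> [_ Pmin] IQ QP; apply: spec_inj; apply/seteqP; split=> //.
exact: Pmin.
Qed.

(** A prime outside V(S) omits some d in S, so the sets of primes omitting a single element form a
    base. *)
Lemma zariski_nbhsP P (V : set (spec D)) :
  nbhs P V <-> exists2 d, ~ ideal_set P d & forall Q, ~ ideal_set Q d -> V Q.
Proof.
rewrite nbhsE.
split=> [[U [[S ->] /existsNP[d /not_implyP[Sd Pd]]] UV]|[d Pd dV]].
  by exists d => // Q Qd; apply: UV => /(_ _ Sd).
exists (~` [set Q : spec D | [set d] `<=` Q]); last first.
  by move=> Q /= dQ; apply: dV => Qd; apply: dQ => _ ->.
by split; [exists [set d]|move=> /(_ _ erefl)].
Qed.

Lemma zariski_isolatedP (X : set (spec D)) P :
  isolated X P <->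
  X P /\ exists2 d, ~ ideal_set P d & forall Q, X Q -> Q <> P -> ideal_set Q d.
Proof.
split=> [[/set_mem XP [V /zariski_nbhsP[d Pd dV] VX]]|[XP [d Pd dX]]].
  split=> //; exists d => // Q XQ QP; apply: contrapT => Qd.
  by have : [set P] Q by rewrite -VX; split=> //; exact: dV.
split; first exact: mem_set.
exists [set Q : spec D | ~ ideal_set Q d]; first by apply/zariski_nbhsP; exists d.
apply/seteqP; split=> [Q [/= Qd XQ]|_ -> //].
by apply: contrapT => QP; apply: Qd; exact: dX.
Qed.

Definition radical_ideal I : Prop :=
  forall a n, ideal_set I (a ^+ n) -> ideal_set I a.

Section MultiplicativeSaturation.
Variables (S : set D) (I : ideal D).
Hypotheses (S1 : S 1) (SM : forall a b, S a -> S b -> S (a * b)).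

Let satset : set D := [set a | exists2 s, S s & ideal_set I (s * a)].

Lemma satset0 : satset 0.
Proof. by exists 1 => //; rewrite mulr0; exact: ideal0. Qed.

Lemma satsetD a b : satset a -> satset b -> satset (a + b).
Proof.
move=> [s Ss Ia] [t St Ib]; exists (s * t); first exact: SM.
rewrite mulrDr; apply: idealD; last by rewrite -mulrA; exact: idealM.
by rewrite (mulrC s) -mulrA; exact: idealM.
Qed.

Lemma satsetM d a : satset a -> satset (d * a).
Proof. by move=> [s Ss Ia]; exists s => //; rewrite mulrCA; exact: idealM. Qed.

(* the preimage of S^-1 I in D *)
Definition saturation : ideal D := Ideal satset0 satsetD satsetM.

End MultiplicativeSaturation.

(* The complements of the minimal primes over I are the maximal multiplicative
   sets disjoint from I. *)
Lemma radical_ideal_minimal_prime I a :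
  radical_ideal I -> ~ ideal_set I a ->
  exists2 P, minimal_primes I P & ~ ideal_set P a.
Proof.
move=> Irad Ia.
pose mult (S : set D) := [/\ S 1, S a, forall b c, S b -> S c -> S (b * c) &
  forall b, S b -> ~ ideal_set I b].
have mult_pow : mult [set a ^+ n | n in setT].
  split=> [||_ _ [m _ <-] [n _ <-]|_ [n _ <-]].
  - by exists 0%N; rewrite ?expr0.
  - by exists 1%N; rewrite ?expr1.
  - by exists (m + n)%N; rewrite ?exprD.
  - by move=> /Irad.
(* The guard [S !=set0] admits the empty set, which is the union of the empty chain. *)
have [|S [Smult Smax]] := @Zorn_bigcup _ [set S | S !=set0 -> mult S].
  move=> C CP Ctot [b [S CS Sb]].
  have [S1 Sa _ _] : mult S by apply: CP => //; exists b.
  split=> [||x y [A CA Ax] [B CB By]|x [A CA Ax]]; [by exists S|by exists S| |].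
    wlog AB : x y A B CA CB Ax By / A `<=` B => [wl|].
      have [AB|BA] := Ctot _ _ CA CB; first exact: wl AB.
      by rewrite mulrC; exact: wl BA.
    exists B => //; have [_ _ + _] : mult B by apply: CP => //; exists y.
    by apply=> //; exact: AB.
  by have [_ _ _] : mult A by [apply: CP => //; exists x]; apply.
have {Smult}[S1 Sa SM SI] : mult S.
  apply: Smult; apply: contrapT => S0; apply: (Smax _ _ (fun=> mult_pow)).
  rewrite properEneq; split; last by move=> x Sx; case: S0; exists x.
  by apply/eqP => E; apply: S0; rewrite E; exists 1; exists 0%N; rewrite ?expr0.
pose P := Defs.rad (saturation I S1 SM).
have PS b : ideal_set P b -> ~ S b.
  move=> [n _ [s Ss Isb]] Sb.
  have Sbn : S (b ^+ n) by elim: (n) => [//|k IH]; rewrite exprS; exact: (SM).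
  by apply: (SI _ _ Isb); exact: (SM).
(* Otherwise the products of elements of [S] with powers of [b] form a larger multiplicative set
   that is still disjoint from [I]. *)
have SP b : ~ S b -> ideal_set P b.
  move=> Sb; apply: contrapT => Pb.
  pose S' := [set x | exists s n, S s /\ x = s * b ^+ n].
  have SS' : S `<=` S' by move=> s Ss; exists s, 0%N; rewrite expr0 mulr1.
  have S'b : S' b by exists 1, 1%N; rewrite expr1 mul1r.
  apply: (Smax S').
    by rewrite properEneq; split=> //; apply/eqP => E; apply: Sb; rewrite E.
  move=> _; split; [exact: SS'|exact: SS'| |].
    move=> _ _ [s [m [Ss ->]]] [t [n [St ->]]]; exists (s * t), (m + n)%N.
    by split; [exact: (SM)|rewrite exprD mulrACA].
  move=> _ [s [[|n] [Ss ->]]] Is; apply: Pb.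
    by case: (SI _ Ss); rewrite expr0 mulr1 in Is.
  by exists n.+1 => //; exists s.
have P1 : ~ ideal_set P 1 by move=> /PS.
have Pprime b c : ideal_set P (b * c) -> ideal_set P b \/ ideal_set P c.
  move=> /PS Sbc; apply: contrapT => /not_orP[Pb Pc]; apply: Sbc.
  by apply: (SM); apply: contrapT => /SP.
exists (Spec P1 Pprime); last by move=> /= /PS.
split=> [b Ib|Q IQ QP b [n _ [s Ss Isb]]] /=; first by apply: SP => /SI.
(* Here [s * b ^+ n] lies in [Q], while [s] does not, as [Q] is inside the complement [P] of [S]. *)
apply: (@specX _ _ n); have /spec_prime[/QP/PS//|//] := IQ _ Isb.
Qed.

Section Conductor.
Variables (M : submod D) (x : {fraction D}).

Let condset : set D := [set d | submod_set M (d%:F * x)].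

Lemma condset0 : condset 0.
Proof. by rewrite /condset /= tofrac0 mul0r; exact: submod0. Qed.

Lemma condsetD a b : condset a -> condset b -> condset (a + b).
Proof. by rewrite /condset /= tofracD mulrDl; exact: submodD. Qed.

Lemma condsetM d a : condset a -> condset (d * a).
Proof. by rewrite /condset /= tofracM -mulrA; exact: submodM. Qed.

(* the ideal (M :_D x) *)
Definition conductor : ideal D := Ideal condset0 condsetD condsetM.

End Conductor.

Lemma submod_of_idealE I a :
  submod_set (submod_of_ideal I) a%:F <-> ideal_set I a.
Proof.
split=> [[b Ib /eqP]|Ia]; last by exists a.
by rewrite tofrac_eq => /eqP <-.
Qed.

Lemma conductor_idealE I a d :
  ideal_set (conductor (submod_of_ideal I) a%:F) d <-> ideal_set I (d * a).
Proof. by rewrite /= -tofracM; exact: submod_of_idealE. Qed.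

Lemma submod_of_idealS I J :
  I `<=` J -> submod_of_ideal I `<=` submod_of_ideal J.
Proof. by move=> IJ _ [a Ia <-]; exists a => //; exact: IJ. Qed.

Lemma submod_scaleE x M y : x != 0 ->
  submod_set (submod_scale x M) y <-> submod_set M (x^-1 * y).
Proof.
move=> x0; split=> [[z Mz <-]|My]; first by rewrite mulKf.
by exists (x^-1 * y) => //; rewrite mulVKf.
Qed.

Definition full_ideal : ideal D :=
  @Ideal D setT I (fun _ _ _ _ => I) (fun _ _ _ => I).

(** A finite sum of products has a common denominator outside [P]; conversely, x = (s x)(1/s). *)
Lemma submod_locP M P x :
  submod_loc M P x <-> exists2 s, ~ ideal_set P s & submod_set M (s%:F * x).
Proof.
split=> [[n [i [u [Mi Pu ->]]]]|[s Ps Msx]].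
  pose K y := exists2 s, ~ ideal_set P s & submod_set M (s%:F * y).
  apply: (big_ind K) => [|y z [s Ps My] [t Pt Mz]|k _].
  - by exists 1; [exact: spec_proper|rewrite mulr0; exact: submod0].
  - exists (s * t); first by move=> /spec_prime[].
    rewrite tofracM mulrDr; apply: submodD; last first.
      by rewrite -mulrA; exact: submodM.
    by rewrite (mulrC s%:F) -mulrA; exact: submodM.
  - have [a [s [Ps ->]]] := Pu k; exists s => //.
    have s0 : s%:F != 0.
      by rewrite tofrac_eq0; apply/eqP => s0; apply: Ps; rewrite s0; exact: ideal0.
    by rewrite mulrCA (mulrC s%:F) divfK// mulrC; exact: submodM.
have s0 : s%:F != 0.
  by rewrite tofrac_eq0; apply/eqP => s0; apply: Ps; rewrite s0; exact: ideal0.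
exists 1%N, (fun=> s%:F * x), (fun=> s%:F^-1); split=> [//|_|].
  by exists 1, s; rewrite tofrac1 mul1r.
by rewrite big_ord1 mulrAC mulfV// mul1r.
Qed.

End IdealTheory.

(** * Stable operations via conductors, spectral ones via primes *)

Section StableTheory.
Variables (D : idomainType) (star : semistar D).
Implicit Types (I J : ideal D) (M : submod D) (P Q : spec D).

(** For x nonzero, the conductor is the intersection of x^-1 M and D; stability and scaling turn its
    closure into that of x^-1 M^star and D^star. *)
Lemma stable_conductor M x : stable star ->
  submod_set (star M) x <->
  submod_set (star (submod_of_ideal (conductor M x))) 1.
Proof.
move=> st; have star1 I : ideal_set I 1 ->
    submod_set (star (submod_of_ideal I)) 1.
  by move=> I1; apply: star_ext; exists 1; rewrite ?tofrac1.
have [->|x0] := eqVneq x 0.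
  split=> _; last exact: submod0.
  by apply: star1; rewrite /= mulr0; exact: submod0.
have -> : submod_of_ideal (conductor M x) =
    submodI (submod_scale x^-1 M) (submod_of_ideal (full_ideal D)).
  apply: submod_inj; apply/seteqP; split=> [_ [d Md <-]|y].
    by split; [exists (d%:F * x); rewrite // mulrC mulfK|exists d].
  by move=> [[m Mm <-] [d _ E]]; exists d; rewrite //= E mulrAC mulVf// mul1r.
rewrite st star_scale; split=> [sx|[[z sz E] _]].
  by split; [exists x; rewrite ?mulVf|exact: star1].
by rewrite -(mulVKf x0 z) E mulr1 in sz.
Qed.

(** For the converse, [Delta] consists of all primes P with 1 outside P^star. By monotonicity, no
    such P contains the conductor of an element of M^star. *)
Lemma spectral_primes :
  stable star ->
  (spectral star <->
   forall I, ~ submod_set (star (submod_of_ideal I)) 1 ->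
     exists2 P : spec D, I `<=` P & ~ submod_set (star (submod_of_ideal P)) 1).
Proof.
move=> st; split=> [[Delta DE] I I1|sP].
  have [P DP /submod_locP P1] :
      exists2 P, Delta P & ~ submod_loc (submod_of_ideal I) P 1.
    apply: contrapT => NP; apply: I1; rewrite DE => P DP.
    by apply: contrapT => P1; apply: NP; exists P.
  exists P => [a Ia|].
    apply: contrapT => Pa; apply: P1; exists a => //.
    by rewrite mulr1; apply/submod_of_idealE.
  by rewrite DE => /(_ P DP)/submod_locP[s Ps]; rewrite mulr1 => /submod_of_idealE.
exists [set P | ~ submod_set (star (submod_of_ideal P)) 1] => M.
apply/seteqP; split=> [x /(stable_conductor _ _ st) Mx P P1|x Mx].
  apply/submod_locP; apply: contrapT => NP; apply: P1.
  apply: star_mono Mx; apply: submod_of_idealS => d Md.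
  by apply: contrapT => Pd; apply: NP; exists d.
apply/(stable_conductor _ _ st); apply: contrapT.
move=> /sP[P MP /Mx/submod_locP[s Ps]].
by move=> /MP.
Qed.

(* [J = I^star `&` D] is radical, for I radical. If P is isolated in
   [minimal_primes J], say separated by d from the other minimal primes, then
   [d P `<=` J]; so [1 \in P^star] would put d into J, hence into P. *)
Lemma min_scattered_spectral : min_scattered D -> radical star -> spectral star.
Proof.
move=> scat [qr st]; apply/spectral_primes => // I0 /qr; set I := Defs.rad I0 => I1.
pose SI := star (submod_of_ideal I).
pose J := conductor SI 1.
have JE d : ideal_set J d <-> submod_set SI d%:F by rewrite /J /= mulr1.
have IJ : I `<=` J by move=> d Id; apply/JE; apply: star_ext; exists d.
have Irad : radical_ideal I.
  move=> a [|n]; first by rewrite -[a]mulr1; exact: idealM.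
  by move=> [m m0 Im]; exists (n.+1 * m)%N; rewrite ?muln_gt0// exprM.
have Jrad : radical_ideal J.
  (* As [I] is radical, the conductor of a^n into [I] is contained in that of a. *)
  move=> a n /JE/(stable_conductor _ _ st) an; apply/JE/(stable_conductor _ _ st).
  apply: star_mono an; apply: submod_of_idealS => d.
  move=> /conductor_idealE Id; apply/conductor_idealE.
  case: n Id => [|n Id]; first by rewrite mulr1 mulrC; exact: idealM.
  by apply: (Irad _ n.+1); rewrite exprMn exprSr -mulrA; exact: idealM.
have J1 : ~ ideal_set J 1 by rewrite JE tofrac1.
have [P [JP [d Pd dX]]] : exists P, minimal_primes J P /\
    exists2 d, ~ ideal_set P d &
      forall Q, minimal_primes J Q -> Q <> P -> ideal_set Q d.
  have [P minP _] := radical_ideal_minimal_prime Jrad J1.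
  have [|Q /zariski_isolatedP] := scattered_isolated (scat J) (@subset_refl _ _).
    by exists P.
  by exists Q.
have [JsubP _] := JP.
exists P => [a I0a|P1]; first by apply/JsubP/IJ; exists 1%N; rewrite ?expr1.
apply: Pd; apply: JsubP; apply/JE; rewrite -[SI]star_idem.
apply/(stable_conductor _ _ st); apply: star_mono P1; apply: submod_of_idealS => p Pp.
rewrite /= -tofracM; apply/JE; apply: contrapT.
move=> /(radical_ideal_minimal_prime Jrad)[Q minQ]; apply.
have [->|QP] := pselect (Q = P); first by rewrite mulrC; exact: idealM.
by apply: idealM; exact: dX.
Qed.

End StableTheory.

(** * Stable semistar operations from localizing systems of ideals *)

Section LocalizingSystem.
Variables (D : idomainType) (F : set (ideal D)).
Implicit Types (I J : ideal D) (M N : submod D).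
Hypotheses (Ffull : F (full_ideal D))
  (FS : forall I J, I `<=` J -> F I -> F J)
  (Ftrans : forall I J, F I ->
    (forall a, ideal_set I a -> F (conductor (submod_of_ideal J) a%:F)) -> F J)
  (F0 : forall I, F I -> exists2 a, ideal_set I a & a != 0).

(** For a in [I], the conductor of a into [K] contains [J], so [Ftrans] applies. *)
Lemma localizing_cap I J (K : ideal D) : I `&` J `<=` K -> F I -> F J -> F K.
Proof.
move=> IJK FI FJ; apply: (Ftrans FI) => a Ia; apply: FS FJ => b Jb.
apply/conductor_idealE; apply: IJK.
by split; [exact: idealM|rewrite mulrC; exact: idealM].
Qed.

Let starset M : set {fraction D} := [set x | F (conductor M x)].

Lemma starset0 M : starset M 0.
Proof. by apply: FS Ffull => d _ /=; rewrite mulr0; exact: submod0. Qed.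

Lemma starsetD M x y : starset M x -> starset M y -> starset M (x + y).
Proof.
by apply: localizing_cap => d [/= Mx My]; rewrite mulrDr; exact: submodD.
Qed.

Lemma starsetM M (d : D) x : starset M x -> starset M (d%:F * x).
Proof. by apply: FS => b /= Mx; rewrite mulrCA; exact: submodM. Qed.

Definition localizing_star M : submod D :=
  Submod (@starset0 M) (@starsetD M) (@starsetM M).

Lemma localizing_star_ext M : M `<=` localizing_star M.
Proof. by move=> x Mx; apply: FS Ffull => d _ /=; exact: submodM. Qed.

Lemma localizing_star_mono M N :
  M `<=` N -> localizing_star M `<=` localizing_star N.
Proof. by move=> MN x; apply: FS => d /= /MN. Qed.

(** If a x is in the closure of [M], then (M : a x) is in [F] and lies in ((M : x) : a); [Ftrans]
    then puts (M : x) in [F]. *)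
Lemma localizing_star_idem M :
  localizing_star (localizing_star M) = localizing_star M.
Proof.
apply: submod_inj; apply/seteqP; split; last exact: localizing_star_ext.
move=> x FMx; apply: (Ftrans FMx) => a; apply: FS => b Mabx.
by apply/conductor_idealE; rewrite /= tofracM -mulrA.
Qed.

Lemma localizing_star_scale x M :
  localizing_star (submod_scale x M) = submod_scale x (localizing_star M).
Proof.
apply: submod_inj; apply/seteqP; have [->|x0] := eqVneq x 0; split=> y.
(* For x = 0, [F0] gives a nonzero a with a y = 0. *)
- move=> /F0[a /= [m _ /esym/eqP]]; rewrite mul0r mulf_eq0 tofrac_eq0.
  move=> /orP[->//|/eqP ->] _.
  by exists 0; [exact: (submod0 (localizing_star M))|rewrite mul0r].
- by move=> [z _ <-]; rewrite mul0r; exact: submod0.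
- move=> Fy; apply/(submod_scaleE _ _ x0); apply: FS Fy => d.
  by move=> /(submod_scaleE _ _ x0) /=; rewrite mulrCA.
- move=> /(submod_scaleE _ _ x0); apply: FS => d /= Md.
  by apply/(submod_scaleE _ _ x0); rewrite mulrCA.
Qed.

Definition localizing_semistar : semistar D :=
  Semistar localizing_star_ext localizing_star_mono localizing_star_idem
    localizing_star_scale.

Lemma localizing_semistar1 I :
  submod_set (localizing_semistar (submod_of_ideal I)) 1 <-> F I.
Proof.
split; apply: FS => a.
  by move=> /= [b Ib /eqP]; rewrite mulr1 tofrac_eq => /eqP <-.
by move=> Ia /=; rewrite mulr1; exists a.
Qed.

Lemma localizing_semistar_stable : stable localizing_semistar.
Proof.
move=> M N; apply: submod_inj; apply/seteqP; split=> x.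
  by move=> FMN; split; apply: FS FMN => d [].
by move=> [FM FN]; apply: localizing_cap FM FN.
Qed.

End LocalizingSystem.

(** * The radical operation of a set of minimal primes without isolated points *)

Section DenseInItself.
Variables (D : idomainType) (I0 : ideal D) (X : set (spec D)).
Hypotheses (XI0 : X `<=` minimal_primes I0) (X0 : X !=set0)
  (Xiso : isolated X = set0).
Implicit Types (I J : ideal D).

(* [V(I) `&` X] is nowhere dense in X *)
Definition codense I : Prop := forall d P, X P -> ~ ideal_set P d ->
  exists Q, [/\ X Q, ~ ideal_set Q d & ~ I `<=` Q].

Lemma codense_full : codense (full_ideal D).
Proof. by move=> d P XP Pd; exists P; split=> // /(_ 1 I)/spec_proper. Qed.

Lemma codenseS I J : I `<=` J -> codense I -> codense J.
Proof.
move=> IJ cI d P XP /(cI _ _ XP)[Q [XQ Qd IQ]]; exists Q; split=> // JQ.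
exact: IQ (subset_trans IJ JQ).
Qed.

(** Codensity of [I] gives [Q] omitting d and some a in [I]. Codensity of (J : a), applied to d a,
    gives [Q'] omitting a and not containing (J : a), hence not containing [J]. *)
Lemma codense_trans I J : codense I ->
  (forall a, ideal_set I a -> codense (conductor (submod_of_ideal J) a%:F)) ->
  codense J.
Proof.
move=> cI cJ d P XP /(cI _ _ XP)[Q [XQ Qd /existsNP[a /not_implyP[Ia Qa]]]].
have Qda : ~ ideal_set Q (d * a) by move=> /spec_prime[].
have [Q' [XQ' Q'da JQ']] := cJ _ Ia _ _ XQ Qda.
exists Q'; split=> [//|Q'd|JsubQ'].
  by apply: Q'da; rewrite mulrC; exact: idealM.
apply: JQ' => b /conductor_idealE/JsubQ'.
by case/spec_prime=> // Q'a; case: Q'da; exact: idealM.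
Qed.

Lemma codense_neq0 I : codense I -> exists2 a, ideal_set I a & a != 0.
Proof.
move=> cI; have [P XP] := X0.
have [Q [_ _ /existsNP[a /not_implyP[Ia Qa]]]] := cI 1 _ XP (@spec_proper _ P).
by exists a => //; apply/eqP => a0; apply: Qa; rewrite a0; exact: ideal0.
Qed.

Definition codense_semistar : semistar D :=
  localizing_semistar codense_full codenseS codense_trans codense_neq0.

(** A prime containing [I] contains its radical. *)
Lemma codense_semistar_radical : radical codense_semistar.
Proof.
split; last exact: localizing_semistar_stable.
move=> I NI; apply: contra_not NI => /localizing_semistar1 cI.
apply/localizing_semistar1 => d P XP /(cI _ _ XP)[Q [XQ Qd IQ]].
by exists Q; split=> // IsubQ; apply: IQ => a [n _ /IsubQ/specX].
Qed.

(* A prime containing [\bigcap_(P in X) P] lies in at most one element of X. *)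
Lemma codense_semistar_not_spectral : ~ spectral codense_semistar.
Proof.
move=> /(spectral_primes (localizing_semistar_stable _ _ _ _)) sP.
have [P XP] := X0.
pose K0 : set D := [set a | forall Q, X Q -> ideal_set Q a].
have K00 : K0 0 by move=> Q _; exact: ideal0.
have K0D a b : K0 a -> K0 b -> K0 (a + b).
  by move=> Ka Kb Q XQ; apply: idealD; [exact: Ka|exact: Kb].
have K0M d a : K0 a -> K0 (d * a) by move=> Ka Q XQ; apply: idealM; exact: Ka.
have [|Q KQ] := sP (Ideal K00 K0D K0M).
  move=> /localizing_semistar1/(_ 1 P XP (@spec_proper _ P))[Q [XQ _]].
  by apply=> a /(_ Q XQ).
apply; apply/localizing_semistar1 => d P1 XP1 P1d.
apply: contrapT => NQ.
(* Every point of [X] omitting [d] contains [Q], by [NQ]; as [Q] contains [I0], minimality gives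
   equality. *)
have QP P2 : X P2 -> ~ ideal_set P2 d -> Q = P2.
  move=> XP2 P2d; apply: (minimal_prime_eq (XI0 XP2)).
    move=> a I0a; apply: KQ => R /XI0[I0R _]; exact: I0R.
  by apply: contrapT => QP2; apply: NQ; exists P2.
have : isolated X P1.
  apply/zariski_isolatedP; split=> //; exists d => // P2 XP2 P21.
  by apply: contrapT => P2d; apply: P21; rewrite -(QP _ XP1 P1d) -(QP _ XP2 P2d).
by rewrite Xiso.
Qed.

End DenseInItself.

Theorem theorem6p5 (D : idomainType) (hD : rad_colon_coherent D) :
  min_scattered D <->
  (forall star : semistar D, radical star -> spectral star).
Proof.
split=> [scat star|spectral_of_radical I]; first exact: min_scattered_spectral.
apply: isolated_scattered => X XI X0; apply/set0P/eqP => Xiso.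
have := spectral_of_radical _ (codense_semistar_radical X0).
exact: (codense_semistar_not_spectral XI Xiso).
Qed.
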